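(* Let $A$ be an $m \times n$ real matrix. The following two statements are equivalent. (1) For all $\mathbf{x}_1, \mathbf{x}_2 \in \mathbb{R}^n$: if $A\mathbf{x}_1 \leq A\mathbf{x}_2$, then there exist vectors $\mathbf{x}_1', \mathbf{x}_2' \in \mathbb{R}^n$ such that $A\mathbf{x}_1 = A\mathbf{x}_1'$, $A\mathbf{x}_2 = A\mathbf{x}_2'$, and $\mathbf{x}_1' \leq \mathbf{x}_2'$. (2) For all $\mathbf{x}_1, \mathbf{x}_2, \mathbf{x}_3 \in \mathbb{R}^n$: if $A\mathbf{x}_1 \leq A\mathbf{x}_2 \leq A\mathbf{x}_3$, then there exist vectors $\mathbf{x}_1', \mathbf{x}_2', \mathbf{x}_3' \in \mathbb{R}^n$ such that $A\mathbf{x}_1 = A\mathbf{x}_1'$, $A\mathbf{x}_2 = A\mathbf{x}_2'$, $A\mathbf{x}_3 = A\mathbf{x}_3'$, and $\mathbf{x}_1' \leq \mathbf{x}_2' \leq \mathbf{x}_3'$.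
   Context: For vectors $\mathbf{u}=(u_1,\dots,u_k)$ and $\mathbf{v}=(v_1,\dots,v_k)$ in $\mathbb{R}^k$, $\mathbf{u} \leq \mathbf{v}$ means $u_j \leq v_j$ for every $j=1,\dots,k$ (the componentwise partial order). Vectors are column vectors. *)

(* Defs.v *)
From mathcomp Require Import all_boot all_order all_algebra.
From mathcomp Require Import reals.

Set Implicit Arguments.
Unset Strict Implicit.
Unset Printing Implicit Defensive.

Import Order.TTheory GRing.Theory Num.Theory.
Local Open Scope ring_scope.

Definition lecv (R : realType) (k : nat) (u v : 'cV[R]_k) : Prop :=
  forall j : 'I_k, u j 0 <= v j 0.

(* Main.v *)
(** Only the increments matter: if (a1, a2) and (b2, b3) are ordered lifts of
    (A x1, A x2) and (A x2, A x3), then adding the nonnegative increments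
    a2 - a1 and b3 - b2 successively to x1 gives an ordered lift of the chain. *)
Require Import Defs.
From mathcomp Require Import all_boot all_order all_algebra.
From mathcomp Require Import reals.

Set Implicit Arguments.
Unset Strict Implicit.
Unset Printing Implicit Defensive.

Import Order.TTheory GRing.Theory Num.Theory.
Local Open Scope ring_scope.

Theorem proposition2 (R : realType) (m n : nat) (A : 'M[R]_(m, n)) :
  (forall x1 x2 : 'cV[R]_n,
     lecv (A *m x1) (A *m x2) ->
     exists x1' x2' : 'cV[R]_n,
       [/\ A *m x1 = A *m x1', A *m x2 = A *m x2' & lecv x1' x2'])
  <->
  (forall x1 x2 x3 : 'cV[R]_n,
     lecv (A *m x1) (A *m x2) /\ lecv (A *m x2) (A *m x3) ->
     exists x1' x2' x3' : 'cV[R]_n,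
       [/\ A *m x1 = A *m x1', A *m x2 = A *m x2', A *m x3 = A *m x3'
         & lecv x1' x2' /\ lecv x2' x3']).
Proof.
split=> [mono2 x1 x2 x3 [le12 le23] | mono3 x1 x2 le12].
- have [a1 [a2 [A1 A2 le_a]]] := mono2 _ _ le12.
  have [b2 [b3 [B2 B3 le_b]]] := mono2 _ _ le23.
  (* The lifts [a2] and [b2] of [A *m x2] may differ, so the two pairs cannot simply be joined at
     the middle; rebuilding the chain from [x1] avoids this. *)
  exists x1, (x1 + (a2 - a1)), (x1 + (a2 - a1) + (b3 - b2)).
  (* The increment [a2 - a1] has image [A *m x2 - A *m x1], which telescopes. *)
  have Ay2 : A *m (x1 + (a2 - a1)) = A *m x2.
    by rewrite mulmxDr mulmxBr -A1 -A2 addrC subrK.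
  split=> //; first by rewrite mulmxDr Ay2 mulmxBr -B2 -B3 addrC subrK.
  by split=> j; rewrite [leRHS]mxE lerDl !mxE subr_ge0.
(* Repeating [x2] turns the pair into a chain of three; the third lift is discarded. *)
- have le22 : lecv (A *m x2) (A *m x2) by move=> j.
  have [y1 [y2 [_ [A1 A2 _ [le_y _]]]]] := mono3 _ _ _ (conj le12 le22).
  by exists y1, y2.
Qed.
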